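(* Let $\mathcal{F}$ be a finite family of axis-parallel rectangles in $\mathbb{R}^2$. Suppose that there exists a maximum matching $\mathcal{M}$ in $\mathcal{F}$ such that for every $F\in\mathcal{F}$ and $M\in\mathcal{M}$, if $F$ and $M$ intersect then they intersect at a corner. Then $\tau(\mathcal{F}) \leq 16\,\nu(\mathcal{F})$.
   Context: An axis-parallel rectangle in $\mathbb{R}^2$ is a set $[x_1,y_1]\times[x_2,y_2]$ with $x_i<y_i$ for $i=1,2$; its corners are its four vertices. Two rectangles intersect at a corner if one of them contains a corner of the other. A matching in $\mathcal{F}$ is a subfamily of pairwise disjoint rectangles; $\nu(\mathcal{F})$ is the maximum size of a matching in $\mathcal{F}$, and a maximum matching is one of size $\nu(\mathcal{F})$. The covering number $\tau(\mathcal{F})$ is the minimum size of a set of points in $\mathbb{R}^2$ that meets every rectangle in $\mathcal{F}$. *)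

(* Defs.v *)
From HB Require Import structures.
From mathcomp Require Import all_boot all_order all_algebra.
From mathcomp Require Import finmap.
From mathcomp Require Import boolp classical_sets set_interval reals.

Set Implicit Arguments.
Unset Strict Implicit.
Unset Printing Implicit Defensive.

Import Order.TTheory GRing.Theory Num.Theory.
Local Open Scope fset_scope.
Local Open Scope classical_set_scope.
Local Open Scope ring_scope.

(* The value ((x1, y1), (x2, y2)) encodes [x1, y1] x [x2, y2].  Since the
   sides are nondegenerate, equality of rectangles is equality of the
   underlying point sets. *)
Record rectangle (R : realType) := Rectangle {
  sides : (R * R) * (R * R);
  _ : (sides.1.1 < sides.1.2) && (sides.2.1 < sides.2.2)
}.

HB.instance Definition _ (R : realType) := [isSub for @sides R].
HB.instance Definition _ (R : realType) := [Choice of rectangle R by <:].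

Section Rectangles.
Variable R : realType.
Implicit Types (A B : rectangle R) (F M : {fset rectangle R}).

Definition region A : set (R * R) :=
  `[(sides A).1.1, (sides A).1.2] `*` `[(sides A).2.1, (sides A).2.2].

Definition corners A : seq (R * R) :=
  [:: ((sides A).1.1, (sides A).2.1); ((sides A).1.1, (sides A).2.2);
      ((sides A).1.2, (sides A).2.1); ((sides A).1.2, (sides A).2.2)].

Definition intersect A B : Prop := region A `&` region B !=set0.

Definition contains_corner A B : Prop :=
  exists2 c, c \in corners B & region A c.

Definition intersect_at_corner A B : Prop :=
  contains_corner A B \/ contains_corner B A.

Definition matching F M : Prop :=
  (M `<=` F)%fset /\ trivIset [set` M] region.

Definition nu F : nat :=
  (\max_(M <- fpowerset F | `[< matching F M >]) #|` M|)%N.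

Definition maximum_matching F M : Prop :=
  matching F M /\ #|` M| = nu F.

Definition pierces F (P : {fset R * R}) : Prop :=
  forall A, A \in F -> [set` P] `&` region A !=set0.

Lemma piercing_exists F :
  exists n, `[< exists2 P, pierces F P & #|` P| = n >].
Proof.
pose P := [fset ((sides A).1.1, (sides A).2.1) | A in F]%fset.
exists #|` P|; apply/asboolP; exists P => [A AF|//].
exists ((sides A).1.1, (sides A).2.1); split => /=; first exact: in_imfset.
have /andP[lt1 lt2] := valP A.
by split; rewrite /= in_itv /= lexx ltW.
Qed.

Definition tau F : nat := ex_minn (piercing_exists F).

End Rectangles.

(* Main.v *)
Require Import Defs.
From HB Require Import structures.
From mathcomp Require Import all_boot all_order all_algebra.
From mathcomp Require Import finmap.
From mathcomp Require Import boolp classical_sets set_interval reals.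

(** Let [M] be the given maximum matching, of size [k = nu F].  The [4k]
    corners of [M] pierce every rectangle containing one of them.  Let [A] be
    any other rectangle of [F].  Whenever [A] meets some [B] in [M], a corner of
    [A] lies in [B] while no corner of [B] lies in [A], and this forces [B] to
    contain a whole side of [A] ([corner_holds_side]).  The members of [M] being
    disjoint, two of them can only contain opposite sides of [A]; and [A] meets
    at least one of them by maximality.  Hence ([meets_only_or_bridge]) either
    [A] meets exactly one member of [M], or it is a bridge: along some axis it
    leads from one member of [M] to another one and meets no third.

    Rectangles that meet only a given [B] intersect pairwise, since two disjoint
    ones could replace [B] in [M].  By Helly's theorem for boxes one point
    pierces them all, so that [k] points take care of the first kind
    ([meets_only_pierce]).

    For the bridges along a fixed axis, those with the same two ends [B], [C]
    all cross the gap between [B] and [C], where they behave like intervals.  A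
    greedy choice gives a set [D] of bridges, no two of which intersect and
    share both ends, together with one point for each element of [D], such that
    these points pierce all bridges ([greedy]).  To bound the size of [D], take
    any [S] and keep the elements of [D] whose lower end is in [S] and whose
    upper end is not.  If two of these intersected, the end of one would meet
    the other and would thus be one of its ends, namely the corresponding one
    because of [S]; they would share both ends ([bridge_crossing]).  So the kept
    bridges form a matching and there are at most [k] of them.  A random [S]
    keeps a bridge with probability 1/4, whence [#|D| <= 4k]
    ([separation_bound]).

    Altogether [4k + k + 4k + 4k = 13k] points suffice. *)

Set Implicit Arguments.
Unset Strict Implicit.
Unset Printing Implicit Defensive.

Import Order.TTheory Num.Theory.
Local Open Scope fset_scope.
Local Open Scope ring_scope.

(** * Greedy choice and averaging over cuts *)

Lemma max_exists (K : eqType) (R : realType) (f : K -> R) (s : seq K) :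
  s != [::] -> exists2 x, x \in s & forall y, y \in s -> f y <= f x.
Proof.
elim: s => // a [_ _|b s IH _].
  by exists a => [|y]; rewrite inE // => /eqP->.
have [//|x xs xmax] := IH.
have [le_ax|lt_xa] := leP (f a) (f x).
  by exists x => [|y]; rewrite inE ?xs ?orbT // => /predU1P[->|/xmax].
exists a => [|y]; rewrite inE ?eqxx // => /predU1P[->//|/xmax le_yx].
exact: le_trans le_yx (ltW lt_xa).
Qed.

(** Interval-style greedy: take [x] with the largest [f x], discard everything
    that [x] hits, and recurse.  Nothing that is left conflicts with [x], as it
    would have been hit. *)
Lemma greedy (K : choiceType) (R : realType) (f : K -> R)
    (conf hit : K -> K -> Prop) (G : {fset K}) :
  (forall x y, conf x y -> conf y x) ->
  {in G, forall x, hit x x} ->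
  {in G &, forall x y, f y <= f x -> conf x y -> hit x y} ->
  exists D : {fset K}, [/\ D `<=` G, {in D &, forall x y, conf x y -> x = y}
    & {in G, forall y, exists2 x, x \in D & hit x y}].
Proof.
move=> confC; move: {2}#|`G| (leqnn #|`G|) => n.
elim: n G => [|n IH] G leGn hitxx hitG.
  move: leGn; rewrite leqn0 => /eqP/cardfs0_eq->.
  by exists fset0; split => // x; rewrite inE.
have [->|G0] := eqVneq G fset0.
  by exists fset0; split => // x; rewrite inE.
have [|x xG xmax] := @max_exists _ _ f G.
  by rewrite -size_eq0 cardfs_eq0.
pose G' := [fset y in G | ~~ `[< hit x y >]].
have sG'G : G' `<=` G by apply/fsubsetP => y; rewrite !inE => /andP[].
have [||y yG'|D [sDG' indD hitD]] := IH G'.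
- move: leGn; rewrite (cardfsD1 x) xG add1n ltnS; apply: leq_trans.
  apply/fsubset_leq_card/fsubsetP => y; rewrite !inE => /andP[yG /asboolPn hxy].
  rewrite yG andbT; apply: contra_not_neq hxy => ->; exact: hitxx.
- by move=> y /(fsubsetP sG'G) /hitxx.
- by move=> z /(fsubsetP sG'G) zG; apply: hitG => //; apply: (fsubsetP sG'G).
have noconf y : y \in D -> ~ conf x y.
  move=> /(fsubsetP sDG'); rewrite !inE => /andP[yG /asboolPn nhit] cxy.
  by apply: nhit; apply: hitG (cxy) => //; apply: xmax.
exists (x |` D); split.
- by rewrite fsubUset fsub1set xG (fsubset_trans sDG').
- move=> y z; rewrite !inE => /predU1P[->|yD] /predU1P[->|zD] //.
  + by move=> /(noconf _ zD).
  + by move=> /confC /(noconf _ yD).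
  + exact: indD.
- move=> y yG; have [hxy|nhxy] := pselect (hit x y).
    by exists x => //; rewrite !inE eqxx.
  have [|z zD hzy] := hitD y; first by rewrite !inE yG; apply/asboolP.
  by exists z => //; rewrite !inE zD orbT.
Qed.

(** At least a quarter of the subsets of [V] contain [a] but not [b]: adding [a]
    is injective on the subsets of [V] without [a] and [b]. *)
Lemma card_separating (K : choiceType) (V : {fset K}) (a b : K)
    (P : pred {fset K}) :
  a \in V -> b \in V -> a != b ->
  (forall S, a \in S -> b \notin S -> P S) ->
  (2 ^ #|`V| <= 4 * \sum_(S <- fpowerset V | P S) 1)%N.
Proof.
move=> aV bV ab PS.
pose W := (V `\ a) `\ b.
have cV : #|`V| = #|`W|.+2.
  by rewrite (cardfsD1 a) aV (cardfsD1 b (V `\ a)) !inE bV eq_sym ab.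
pose I := [fset a |` S | S in fpowerset W].
have cI : #|`I| = (2 ^ #|`W|)%N.
  rewrite card_in_imfset ?card_fpowerset //= => S S'.
  rewrite !fpowersetE => /fsubsetP sS /fsubsetP sS' /fsetP eqS.
  apply/fsetP => x; have := eqS x; rewrite !inE.
  have [->|//] := eqVneq x a => _.
  by apply/idP/idP => [/sS|/sS']; rewrite !inE eqxx andbF.
rewrite cV !expnS mulnA leq_mul2l /= -cI sum1_count -size_filter.
apply: uniq_leq_size; first exact: fset_uniq.
move=> T /imfsetP[/= S]; rewrite fpowersetE => /fsubsetP sS ->.
rewrite mem_filter fpowersetE PS ?inE ?eqxx //=.
  apply/fsubsetP => x; rewrite !inE => /predU1P[->//|/sS].
  by rewrite !inE => /and3P[].
rewrite eq_sym (negPf ab) /=; apply/negP => /sS.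
by rewrite !inE eqxx.
Qed.

(** Double counting of the pairs [(e, S)] with [P e S]: at most [n] for each of
    the [2 ^ #|V|] sets [S], at least [2 ^ #|V| / 4] for each [e]. *)
Lemma separation_bound (K E : choiceType) (V : {fset K}) (D : {fset E})
    (P : E -> pred {fset K}) (n : nat) :
  {in D, forall e, exists a b, [/\ a \in V, b \in V, a != b &
    forall S, a \in S -> b \notin S -> P e S]} ->
  (forall S, #|` [fset e in D | P e S]| <= n)%N ->
  (#|`D| <= 4 * n)%N.
Proof.
move=> sepD leDn; rewrite -(leq_pmul2r (expn_gt0 2 #|`V|)).
apply: (@leq_trans (\sum_(e <- D) 4 * \sum_(S <- fpowerset V | P e S) 1)%N).
  rewrite -sum1_size big_distrl /= big_seq [leqRHS]big_seq.
  apply: leq_sum => e /sepD[a [b [aV bV ab PS]]].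
  by rewrite mul1n; apply: card_separating PS.
rewrite -big_distrr /= -mulnA leq_mul2l /= (exchange_big_dep xpredT) //=.
rewrite -card_fpowerset mulnC -sum1_size big_distrl /=.
apply: leq_sum => S _; rewrite mul1n; apply: leq_trans (leDn S).
rewrite sum1_count -size_filter; apply: uniq_leq_size.
  exact/filter_uniq/fset_uniq.
by move=> e; rewrite mem_filter !inE andbC.
Qed.


(** * Rectangles, one axis at a time *)

Section Geometry.
Variable R : realType.
Implicit Types (A B C : rectangle R) (p : R * R) (i j s : bool).

(** An axis is a boolean, the other one being its negation, so that each
    argument about horizontal and vertical positions is made once. *)
Definition coord i p : R := if i then p.2 else p.1.
(** The point with coordinate [x] on axis [i] and [y] on the other axis. *)
Definition point i (x y : R) : R * R := if i then (y, x) else (x, y).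
Definition extent i A : R * R := if i then (sides A).2 else (sides A).1.
Definition lo i A := (extent i A).1.
Definition hi i A := (extent i A).2.
Definition side s i A := if s then hi i A else lo i A.

Lemma coord_point i x y : coord i (point i x y) = x.
Proof. by case: i. Qed.

Lemma coord_pointN i x y : coord (~~ i) (point i x y) = y.
Proof. by case: i. Qed.

Lemma forall_axis i (P : bool -> Prop) : P i -> P (~~ i) -> forall j, P j.
Proof. by case: i => ? ? []. Qed.

Lemma lt_lo_hi i A : lo i A < hi i A.
Proof. by have /andP[? ?] := valP A; case: i. Qed.

Lemma side_range s i A : lo i A <= side s i A <= hi i A.
Proof. by have := ltW (lt_lo_hi i A); case: s => /= ->; rewrite lexx. Qed.

Lemma regionP A p :
  region A p <-> forall i, lo i A <= coord i p <= hi i A.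
Proof.
rewrite /region /lo /hi /extent /coord; split=> [[]|in_range].
  by rewrite /= !in_itv /= => ? ? [].
by split; rewrite /= in_itv /=; [have := in_range false|have := in_range true].
Qed.

Lemma intersectP A B :
  intersect A B <-> forall i, lo i A <= hi i B /\ lo i B <= hi i A.
Proof.
split=> [[p [/regionP pA /regionP pB]] i|meet].
  have /andP[A1 A2] := pA i; have /andP[B1 B2] := pB i.
  by split; [apply: le_trans A1 B2|apply: le_trans B1 A2].
(* On each axis the larger of the two lower ends belongs to both intervals. *)
pose x i := Num.max (lo i A) (lo i B).
exists (point false (x false) (x true)).
have x_in i : lo i A <= x i <= hi i A /\ lo i B <= x i <= hi i B.
  have [le1 le2] := meet i.
  by rewrite /x !le_max !lexx !ge_max le1 le2 !(ltW (lt_lo_hi _ _)) orbT.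
by split; apply/regionP => -[]; have [] := x_in true; have [] := x_in false.
Qed.

Lemma intersectC A B : intersect A B -> intersect B A.
Proof. by move=> /intersectP AB; apply/intersectP => i; have [] := AB i. Qed.

Lemma intersectxx A : intersect A A.
Proof. by apply/intersectP => i; rewrite ltW ?lt_lo_hi. Qed.

(** The corners of [B] form the product of the end pairs on the two axes, so
    the end to be used can be selected on each axis independently. *)
Lemma contains_cornerP A B :
  contains_corner A B <->
  forall i, exists s, lo i A <= side s i B <= hi i A.
Proof.
split=> [[c cB /regionP cA] i|ends].
  have := cA i; move: cB; rewrite !inE.
  by case: i => /or4P[]/eqP-> => ?; solve [by exists false|by exists true].
have [[s0 e0] [s1 e1]] := (ends false, ends true).
exists (side s0 false B, side s1 true B).
  by rewrite !inE; case: s0 {e0}; case: s1 {e1}; rewrite eqxx ?orbT.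
by apply/regionP => -[].
Qed.

(** On each axis the largest lower end belongs to all the intervals, because it
    does not exceed any upper end. *)
Lemma helly (G : {fset rectangle R}) :
  {in G &, forall A B, intersect A B} ->
  exists p, forall A, A \in G -> region A p.
Proof.
have [G0 _|G0 meetG] := eqVneq (enum_fset G) [::].
  exists (0, 0) => A; rewrite -[_ \in G]/(A \in enum_fset G) G0.
  by rewrite inE.
have [A AG Amax] := max_exists (lo false) G0.
have [B BG Bmax] := max_exists (lo true) G0.
exists (lo false A, lo true B) => C CG; apply/regionP => -[] /=.
  by rewrite Bmax //=; have /intersectP/(_ true)[] := meetG _ _ BG CG.
by rewrite Amax //=; have /intersectP/(_ false)[] := meetG _ _ AG CG.
Qed.

(** [A] contains the whole side of [B] that is orthogonal to axis [j] and lies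
    at its upper ([s = true]) or lower ([s = false]) end. *)
Definition holds_side s j A B :=
  [/\ lo (~~ j) A <= lo (~~ j) B, hi (~~ j) B <= hi (~~ j) A
    & lo j A <= side s j B <= hi j A].

Lemma holds_side_intersect s j A B : holds_side s j A B -> intersect A B.
Proof.
case=> leA leB /andP[leA' leB'].
have /andP[le1 le2] := side_range s j B.
have ltB := ltW (lt_lo_hi (~~ j) B).
apply/intersectP; apply: (@forall_axis j); split.
- exact: le_trans leA' le2.
- exact: le_trans le1 leB'.
- exact: le_trans leA ltB.
- exact: le_trans ltB leB.
Qed.

(** Two sides of a rectangle that are equal or adjacent have a common corner,
    which lies in every pair of rectangles containing these sides. *)
Lemma holds_side_share s s' j j' A B C :
  holds_side s j A C -> holds_side s' j' B C ->
  (s == s') || (j != j') -> intersect A B.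
Proof.
move=> [A1 A2 /andP[A3 A4]] [B1 B2 /andP[B3 B4]].
have [ej|jj'] := eqVneq j j'; last first.
  move=> _; have ej' : j' = ~~ j by case: (j) (j') jj' => -[].
  subst j'; rewrite negbK in B1 B2.
  have /andP[S1 S2] := side_range s j C.
  have /andP[T1 T2] := side_range s' (~~ j) C.
  apply/intersectP; apply: (@forall_axis j); split.
  - exact: le_trans A3 (le_trans S2 B2).
  - exact: le_trans B1 (le_trans S1 A4).
  - exact: le_trans A1 (le_trans T1 B4).
  - exact: le_trans B3 (le_trans T2 A2).
rewrite orbF => /eqP ss'; subst s' j'.
have ltC := ltW (lt_lo_hi (~~ j) C).
apply/intersectP; apply: (@forall_axis j); split.
- exact: le_trans A3 B4.
- exact: le_trans B3 A4.
- exact: le_trans A1 (le_trans ltC B2).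
- exact: le_trans B1 (le_trans ltC A2).
Qed.

(** Since [B] contains no corner of [A], on some axis [j] it contains neither
    end of [A]; meeting [A] on that axis, it must lie strictly between them.
    The end of [B] that [A] contains on the other axis completes the side. *)
Lemma corner_holds_side A B :
  intersect A B -> contains_corner A B -> ~ contains_corner B A ->
  exists s j, holds_side s j A B.
Proof.
move=> /intersectP meet /contains_cornerP ends nBA.
have [j nends] : exists j, forall s, ~~ (lo j B <= side s j A <= hi j B).
  apply: contrapT => /forallNP nj; apply: nBA; apply/contains_cornerP => i.
  apply: contrapT => /forallNP ns; apply: (nj i) => s; exact/negP/ns.
have [s sA] := ends (~~ j); exists s, (~~ j); split=> //; rewrite negbK.
  have := nends false; rewrite /= [X in _ && X](meet j).1.
  by rewrite andbT -ltNge => /ltW.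
have := nends true; rewrite /= (meet j).2 /=.
by rewrite -ltNge => /ltW.
Qed.

End Geometry.


(** * Rectangles of the family against a maximum matching *)

Section Matchings.
Variables (R : realType) (F : {fset rectangle R}).
Implicit Types (A B C : rectangle R) (M N : {fset rectangle R}).

Lemma matchingP N :
  matching F N <-> (N `<=` F /\ {in N &, forall A B, intersect A B -> A = B}).
Proof.
by split=> -[sNF triv]; split=> // A B AN BN; apply: triv.
Qed.

Lemma matching_leq_nu N : matching F N -> (#|` N| <= nu F)%N.
Proof.
move=> mN; apply: (@leq_bigmax_seq _ _ _ (fun N : {fset _} => #|` N|)).
  by rewrite fpowersetE; case: mN.
exact/asboolP.
Qed.

Lemma matchingU1 A N :
  matching F N -> A \in F -> (forall B, B \in N -> ~ intersect A B) ->
  matching F (A |` N) /\ #|` A |` N| = #|` N|.+1.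
Proof.
move=> /matchingP[sNF triv] AF disj; split; last first.
  rewrite cardfsU1; case: (boolP (A \in N)) => // /disj[].
  exact: intersectxx.
apply/matchingP; split; first by rewrite fsubUset fsub1set AF.
move=> B C; rewrite !inE => /predU1P[->|BN] /predU1P[->|CN] //.
- by move=> /(disj _ CN).
- by move=> /intersectC /(disj _ BN).
- exact: triv.
Qed.

Lemma matchingD1 A N : matching F N -> matching F (N `\ A).
Proof.
move=> /matchingP[sNF triv]; apply/matchingP; split.
  exact: fsubset_trans (fsubD1set _ _) sNF.
by move=> B C; rewrite !inE => /andP[_ BN] /andP[_ CN]; apply: triv.
Qed.

Lemma tau_leq (s : seq (R * R)) :
  {in F, forall A, exists2 p, p \in s & region A p} -> (tau F <= size s)%N.
Proof.
move=> pierce; rewrite /tau; case: ex_minnP => n _ n_min.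
apply: (@leq_trans #|` [fset p in s]|); last first.
  by rewrite card_fseq size_undup.
apply/n_min/asboolP; exists [fset p in s] => // A /pierce[p ps Ap].
by exists p; split=> //=; rewrite inE.
Qed.

Variable M : {fset rectangle R}.
Hypothesis maxM : maximum_matching F M.

Let trivM : {in M &, forall A B, intersect A B -> A = B}.
Proof. by have [/matchingP[]] := maxM. Qed.

Lemma maximum_matching_intersect A :
  A \in F -> exists2 B, B \in M & intersect A B.
Proof.
move=> AF; apply: contrapT => nmeet; have [mM cM] := maxM.
have [|mAM cAM] := matchingU1 mM AF.
  by move=> B BM AB; apply: nmeet; exists B.
by have := matching_leq_nu mAM; rewrite cAM cM ltnn.
Qed.

Definition meets_only A B := forall C, C \in M -> intersect A C -> C = B.

(** Otherwise both rectangles could replace [B] in [M], enlarging it. *)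
Lemma meets_only_intersect A A' B :
  A \in F -> A' \in F -> B \in M -> meets_only A B -> meets_only A' B ->
  intersect A A'.
Proof.
move=> AF A'F BM onlyA onlyA'; apply: contrapT => disj; have [mM cM] := maxM.
have [|m1 c1] := matchingU1 (matchingD1 B mM) AF.
  by move=> C; rewrite !inE => /andP[/eqP CB CM] /(onlyA _ CM).
have [|m2 c2] := matchingU1 m1 A'F.
  move=> C; rewrite !inE => /predU1P[->|/andP[/eqP CB CM]].
    by move=> /intersectC.
  by move=> /(onlyA' _ CM).
have := matching_leq_nu m2.
by rewrite c2 c1 -cM (cardfsD1 B M) BM ltnn.
Qed.

Lemma meets_only_pierce : exists f : rectangle R -> R * R,
  forall A B, A \in F -> B \in M -> meets_only A B -> region A (f B).
Proof.
have /choice[f fP] : forall B, exists p,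
    forall A, A \in F -> B \in M -> meets_only A B -> region A p.
  move=> B; have [BM|nBM] := pselect (B \in M); last by exists (0, 0).
  have [|p pG] := @helly R [fset A in F | `[< meets_only A B >]].
    move=> A A'; rewrite !inE => /andP[AF /asboolP onlyA].
    by move=> /andP[A'F /asboolP onlyA']; apply: meets_only_intersect BM _ _.
  by exists p => A AF _ onlyA; apply: pG; rewrite !inE AF; apply/asboolP.
by exists f => A B; apply: fP.
Qed.

(** A bridge [A] leads along axis [j] from its lower end [B] to its upper end
    [C] without meeting another member of [M]. *)
Definition bridge j A B C :=
  [/\ B \in M, C \in M, holds_side false j B A, holds_side true j C A
    & B != C /\ forall D, D \in M -> intersect A D -> D = B \/ D = C].

(** Two members of [M] that contain equal or adjacent sides of [A] would
    intersect.  So a second member must contain the side opposite to the first,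
    and there is no side left for a third. *)
Lemma meets_only_or_bridge A :
  A \in F ->
  (forall B, B \in M -> intersect A B -> exists s j, holds_side s j B A) ->
  (exists2 B, B \in M & meets_only A B) \/
  (exists j B C, bridge j A B C).
Proof.
move=> AF held; have [B BM AB] := maximum_matching_intersect AF.
have [onlyA|/existsNP[C /not_implyP[CM /not_implyP[AC CB]]]] :=
  pselect (meets_only A B); first by left; exists B.
right.
have [s [j hB]] := held B BM AB; have [t [j' hC]] := held C CM AC.
have share := @holds_side_share R.
have ej : j' = j.
  apply/eqP; apply: contra_notT CB => jj'; apply: trivM => //.
  by apply: share hC hB _; rewrite jj' orbT.
subst j'.
have et : t = ~~ s.
  apply/eqP; case: eqVneq => // ts; case: CB; apply: trivM => //.
  by apply: share hC hB _; case: (t) (s) ts => -[].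
subst t.
have only D : D \in M -> intersect A D -> D = B \/ D = C.
  move=> DM AD; have [u [i hD]] := held D DM AD.
  have [us|nus] := boolP ((u == s) || (i != j)).
    by left; apply: trivM => //; apply: share hD hB us.
  right; apply: trivM => //; apply: share hD hC _.
  by case: (u) (s) nus => -[].
exists j; case: s hB hC => hB hC; [exists C, B|exists B, C]; split=> //.
- by split=> [|D DM /(only _ DM)[]]; [exact/eqP|right|left].
- by split=> //; rewrite eq_sym; exact/eqP.
Qed.

(** Of two intersecting bridges, the one that starts later does so inside the
    other one, so its lower end meets that other bridge and is one of its ends;
    likewise for the one that stops first.  Membership in [S] tells lower ends
    from upper ends, which excludes that one bridge continues the other through
    a common member of [M]. *)
Lemma bridge_crossing j A B C A' B' C' (S : {fset rectangle R}) :
  bridge j A B C -> bridge j A' B' C' -> intersect A A' ->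
  B \in S -> C \notin S -> B' \in S -> C' \notin S -> B = B' /\ C = C'.
Proof.
move=> brA brA' AA' BS CS BS' CS'.
(* A point common to A1 and A2 can be moved along axis j to the lower side of
   A2 without leaving A1; it is then in B2, so that A1 meets B2. *)
have lower A1 B1 C1 A2 B2 C2 : bridge j A1 B1 C1 -> bridge j A2 B2 C2 ->
    intersect A1 A2 -> lo j A1 <= lo j A2 -> B2 \in S -> C1 \notin S ->
    B2 = B1.
  move=> [_ _ _ _ [_ only]] [B2M _ [l1 l2 /andP[l3 l4]] _ _] /intersectP meet.
  move=> le12 B2S C1S; have [m1 m2] := meet j; have [n1 n2] := meet (~~ j).
  have [//|//|e] := only B2 B2M _; last by rewrite -e B2S in C1S.
  apply/intersectP; apply: (@forall_axis j); split.
  - exact: le_trans le12 l4.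
  - exact: le_trans l3 m2.
  - exact: le_trans n1 l2.
  - exact: le_trans l1 n2.
have upper A1 B1 C1 A2 B2 C2 : bridge j A1 B1 C1 -> bridge j A2 B2 C2 ->
    intersect A1 A2 -> hi j A2 <= hi j A1 -> C2 \notin S -> B1 \in S ->
    C2 = C1.
  move=> [_ _ _ _ [_ only]] [_ C2M _ [l1 l2 /andP[l3 l4]] _] /intersectP meet.
  move=> le21 C2S B1S; have [m1 m2] := meet j; have [n1 n2] := meet (~~ j).
  have [//|e|//] := only C2 C2M _; last by rewrite e B1S in C2S.
  apply/intersectP; apply: (@forall_axis j); split.
  - exact: le_trans m1 l4.
  - exact: le_trans l3 le21.
  - exact: le_trans n1 l2.
  - exact: le_trans l1 n2.
have A'A := intersectC AA'.
split.
  have [le12|/ltW le21] := leP (lo j A) (lo j A').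
    by apply/esym; apply: lower brA brA' AA' le12 _ _.
  exact: lower brA' brA A'A le21 _ _.
have [le12|/ltW le21] := leP (hi j A) (hi j A').
  exact: upper brA' brA A'A le12 _ _.
by apply/esym; apply: upper brA brA' AA' le21 _ _.
Qed.

(** The upper end of [B] lies in the extent of every bridge from [B]: it serves
    as the coordinate on axis [j] of a point common to all bridges from [B] to
    [C] that reach a given level on the other axis. *)
Lemma bridge_gap j A B C :
  bridge j A B C -> lo j A <= hi j B <= hi j A.
Proof.
move=> [BM CM hB hC [/eqP BC _]].
have [l1 l2 /andP[l3 ->]] := hB; rewrite leNgt; apply/negP => lt.
have hB' : holds_side true j B A.
  split=> //; rewrite (ltW lt) andbT.
  exact: le_trans l3 (ltW (lt_lo_hi j A)).
by apply: BC; apply: trivM => //; apply: holds_side_share hB' hC _.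
Qed.

Lemma bridges_pierce j : exists s : seq (R * R), (size s <= 4 * nu F)%N /\
  forall A B C, A \in F -> bridge j A B C -> exists2 p, p \in s & region A p.
Proof.
pose isbr A BC := bridge j A BC.1 BC.2.
have /choice[f fP] : forall A, exists BC, (exists BC, isbr A BC) -> isbr A BC.
  move=> A; have [[BC br]|nbr] := pselect (exists BC, isbr A BC).
    by exists BC.
  by exists (A, A).
pose G := [fset A in F | `[< isbr A (f A) >]].
have GP A : A \in G -> A \in F /\ bridge j A (f A).1 (f A).2.
  by rewrite !inE => /andP[? /asboolP].
(* The greedy choice goes by decreasing lower end on the other axis, so this
   lower end is the level at which a chosen bridge hits its rivals. *)
pose pt A := point j (hi j (f A).1) (lo (~~ j) A).
have [|||D [sDG indD hitD]] := @greedy (rectangle R) R (lo (~~ j))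
  (fun A A' => f A = f A' /\ intersect A A') (fun A A' => region A' (pt A)) G.
- by move=> A A' [-> /intersectC].
- move=> A /GP[_ br]; apply/regionP; apply: (@forall_axis j).
    by rewrite coord_point; apply: bridge_gap br.
  by rewrite coord_pointN lexx ltW ?lt_lo_hi.
- move=> A A' /GP[_ br] /GP[_ br'] le [ff /intersectP meet].
  apply/regionP; apply: (@forall_axis j).
    by rewrite coord_point ff; apply: bridge_gap br'.
  by rewrite coord_pointN le; have [] := meet (~~ j).
exists [seq pt A | A <- D]; rewrite size_map; split; last first.
  move=> A B C AF br; have [|A' A'D hit] := hitD A.
    by rewrite !inE AF; apply/asboolP/fP; exists (B, C).
  by exists (pt A') => //; apply: map_f.
apply: (@separation_bound _ _ M D
  (fun A S => ((f A).1 \in S) && ((f A).2 \notin S))).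
  move=> A /(fsubsetP sDG) /GP[_ [BM CM _ _ [BC _]]].
  by exists (f A).1, (f A).2; split=> // S -> ->.
move=> S; apply: matching_leq_nu; apply/matchingP; split.
  apply/fsubsetP => A; rewrite !inE => /andP[AD _].
  by have [] := GP A (fsubsetP sDG _ AD).
move=> A A'; rewrite !inE => /andP[AD /andP[BS CS]] /andP[AD' /andP[BS' CS']].
move=> AA'; apply: indD => //; split=> //.
have [_ br] := GP A (fsubsetP sDG _ AD).
have [_ br'] := GP A' (fsubsetP sDG _ AD').
have [] := bridge_crossing br br' AA' BS CS BS' CS'.
by case: (f A) (f A') => ? ? [? ?] /= -> ->.
Qed.

End Matchings.

Theorem corollary1p9 (R : realType) (F : {fset rectangle R})
    (hF : exists2 M : {fset rectangle R}, maximum_matching F M &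
      forall A B : rectangle R, A \in F -> B \in M ->
        intersect A B -> intersect_at_corner A B) :
  (tau F <= 16 * nu F)%N.
Proof.
have [M maxM corner] := hF; have [_ cM] := maxM.
have [f fP] := meets_only_pierce maxM.
have [s0 [size0 pierce0]] := bridges_pierce maxM false.
have [s1 [size1 pierce1]] := bridges_pierce maxM true.
pose s := [seq c | B <- M, c <- corners B] ++ [seq f B | B <- M] ++ s0 ++ s1.
apply: (@leq_trans (size s)); last first.
  rewrite !size_cat size_allpairs_dep size_map.
  rewrite [sumn _](_ : _ = nu F * 4)%N; last first.
    by rewrite -cM; elim: (enum_fset M) => //= B t ->; rewrite mulSn.
  rewrite -[size _]/(#|` M|) cM.
  apply: (@leq_trans (nu F * 4 + (nu F + (4 * nu F + 4 * nu F)))%N).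
    by rewrite !leq_add2l leq_add.
  by rewrite (mulnC (nu F)) -mulnDl -mulSn -mulnDl leq_mul2r orbT.
apply: tau_leq => A AF.
have [[B BM [c cB Ac]]|nAM] :=
    pselect (exists2 B, B \in M & contains_corner A B).
  exists c => //; rewrite mem_cat; apply/orP; left.
  by apply/allpairsPdep; exists B, c.
have [|[B BM onlyA]|[j [B [C br]]]] := meets_only_or_bridge maxM AF.
- move=> B BM AB; apply: corner_holds_side; first exact: intersectC.
    have [nAB|//] := corner A B AF BM AB.
    by case: nAM; exists B.
  by move=> nAB; apply: nAM; exists B.
- exists (f B); last exact: fP.
  by rewrite !mem_cat map_f ?orbT.
- have [p ps Ap] : exists2 p, p \in s0 ++ s1 & region A p.
    case: j br => br.
      have [p ps1 Ap] := pierce1 A B C AF br.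
      by exists p; rewrite // mem_cat ps1 orbT.
    have [p ps0 Ap] := pierce0 A B C AF br.
    by exists p; rewrite // mem_cat ps0.
  by exists p => //; rewrite !mem_cat -mem_cat ps !orbT.
Qed.
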